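(* Let $\boldsymbol\theta$ be a torsion-free directive sequence with length sequence $(q_n)_{n\ge0}$, defined on a sequence of alphabets of bounded size. Then its tiling factor map $\pi_{\rm tile}:X_{\boldsymbol\theta}\to\mathbb Z_{(q_n)}$ is somewhere $\bar c(\boldsymbol\theta)$-to-$1$ (some fibre $\pi_{\rm tile}^{-1}(z)$ has exactly $\bar c(\boldsymbol\theta)$ elements), and it is not $k$-to-$1$ anywhere for any $k<\bar c(\boldsymbol\theta)$ (no fibre has exactly $k$ elements). Here $\bar c(\boldsymbol\theta)$ is the naïve column number of $\boldsymbol\theta$.
   Context: Alphabets are finite sets. A morphism $\theta:\mathcal A\to\mathcal B^+$ maps letters to non-empty words and is extended by concatenation to words and to $\mathcal A^{\mathbb Z}$. $\sigma$ is the left shift. A directive sequence is a sequence $\boldsymbol\theta=(\theta^{(n)})_{n\ge 0}$ of morphisms $\theta^{(n)}:\mathcal A_{n+1}\to\mathcal A_n^+$; bounded size means $\sup_n|\mathcal A_n|<\infty$. Put $\theta^{[n,N)}=\theta^{(n)}\circ\cdots\circ\theta^{(N-1)}$. $X^{(n)}_{\boldsymbol\theta}$ is the set of $x\in\mathcal A_n^{\mathbb Z}$ all of whose finite subwords are subwords of $\theta^{[n,N)}(a)$ for some $N>n$ and $a\in\mathcal A_N$; $X_{\boldsymbol\theta}=X^{(0)}_{\boldsymbol\theta}$. $\boldsymbol\theta$ is constant-length with length sequence $(q_n)$ if $|\theta^{(n)}(a)|=q_n$ for all $n$ and all $a\in\mathcal A_{n+1}$; $p_0=1$, $p_n=q_0\cdots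 q_{n-1}$. $\boldsymbol\theta$ is injective if each $\theta^{(n)}$ is injective on letters. $\boldsymbol\theta$ is torsion-free if it is constant-length with length sequence $(q_n)$, $q_n>1$ for infinitely many $n$, each $(X^{(n)}_{\boldsymbol\theta},\sigma)$ is minimal, $X^{(0)}_{\boldsymbol\theta}$ is aperiodic (contains no $\sigma$-periodic point), and every prime dividing some $q_k$ divides $q_n$ for infinitely many $n$. $\mathbb Z_{(q_n)}=\varprojlim\mathbb Z/p_n\mathbb Z$ with the map $+1$. A torsion-free $\boldsymbol\theta$ on alphabets of bounded size admits a factor map (continuous equivariant surjection) $\pi_{\rm tile}:(X_{\boldsymbol\theta},\sigma)\to(\mathbb Z_{(q_n)},+1)$, called the tiling factor map; it is unique up to rotation and is normalised to send some limit word to $0$ (a limit word is $u^{(0)}\in X^{(0)}$ for which there are $u^{(n)}\in X^{(n)}$ with $\theta^{(n)}(u^{(n+1)})=u^{(n)}$ for all $n\ge0$). Injectivisation $\widehat{\boldsymbol\theta}$ of $\boldsymbol\theta$: let $\mathcal B_0=\mathcal A_0$, $\tau_0=\mathrm{id}$. Recursively, put $\eta^{(n)}=\tau_n\circ\theta^{(n)}:\mathcal A_{n+1}\to\mathcal B_n^{q_n}$ ($\tau_n$ applied letterwise), let $\tau_{n+1}:\mathcal A_{n+1}\to\mathcal B_{n+1}$ be the quotient map identifying $a,a'$ exactly when $\eta^{(n)}(a)=\eta^{(n)}(a')$, and let $\widehat\theta^{(n)}:\mathcal B_{n+1}\to\mathcal B_n^{q_n}$ be given by $\widehat\theta^{(n)}(b)=\eta^{(n)}(a)$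 for any $a\in\tau_{n+1}^{-1}(b)$. Then $\widehat{\boldsymbol\theta}=(\widehat\theta^{(n)})_{n\ge0}$ is injective with $X_{\widehat{\boldsymbol\theta}}=X_{\boldsymbol\theta}$. Naïve column number: for a morphism $\theta$ of constant length $\ell$ write $\theta(a)=\theta_0(a)\cdots\theta_{\ell-1}(a)$. For injective $\boldsymbol\theta$ let $$c(\boldsymbol\theta,m)=\inf_{n>m}\{|(\theta^{[m,n)})_j(\mathcal A_n)|:0\le j<p_n/p_m\},$$ which is non-decreasing in $m$ and bounded, and $\bar c(\boldsymbol\theta)=\lim_{m\to\infty}c(\boldsymbol\theta,m)=\max_m c(\boldsymbol\theta,m)$. For non-injective $\boldsymbol\theta$, $\bar c(\boldsymbol\theta):=\bar c(\widehat{\boldsymbol\theta})$. *)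

(* Defs.v *)
From HB Require Import structures.
From mathcomp Require Import all_boot all_order all_algebra.
From mathcomp Require Import all_classical topology.

Set Implicit Arguments.
Unset Strict Implicit.
Unset Printing Implicit Defensive.

Import Order.TTheory GRing.Theory Num.Theory.

Local Open Scope classical_set_scope.

(* A^Z with the product of the discrete topologies. *)
Definition fullshift (T : choiceType) :=
  prod_topology (fun _ : int => discrete_topology T).

Definition shift (T : choiceType) (x : fullshift T) : fullshift T :=
  fun i => x (i + 1)%R.

Definition word (T : choiceType) (x : fullshift T) (i : int) (l : nat) : seq T :=
  mkseq (fun j => x (i + j%:Z)%R) l.

Definition minimal (T : choiceType) (X : set (fullshift T)) : Prop :=
  X !=set0 /\
  forall Y : set (fullshift T),
    closed Y -> Y `<=` X -> @shift T @` Y `<=` Y -> Y = set0 \/ Y = X.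

Definition aperiodic (T : choiceType) (X : set (fullshift T)) : Prop :=
  forall x, X x -> forall r : nat, 0 < r -> iter r (@shift T) x <> x.

Record directive (A : nat -> finType) := Directive {
  mor :> forall n, A n.+1 -> seq (A n);
  mor_neq0 : forall n (a : A n.+1), mor a != [::] }.

Section DirectiveSequence.
Variables (A : nat -> finType) (theta : directive A).

(* [compose n k] is theta^[n, n + k), defined on the letters of A_(n + k). *)
Fixpoint compose (n k : nat) : A (k + n) -> seq (A n) :=
  match k return A (k + n) -> seq (A n) with
  | 0 => fun a => [:: a]
  | k'.+1 => fun a : A (k' + n).+1 =>
      flatten [seq @compose n k' b | b <- theta (k' + n) a]
  end.

(* X^(n); the index k.+1 makes N := k.+1 + n range over all N > n. *)
Definition subshift (n : nat) : set (fullshift (A n)) :=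
  [set x | forall i l, exists k, exists a : A (k.+1 + n),
     infix (word x i l) (@compose n k.+1 a)].

Definition constant_length (q : nat -> nat) : Prop :=
  forall n (a : A n.+1), size (theta _ a) = q n.

Definition bounded_size : Prop := exists K, forall n, #|A n| <= K.

Definition injective_letters : Prop := forall n, injective (@mor A theta n).

(* v is the concatenation of the words theta^(n)(u_i), i in Z, with
   theta^(n)(u_0) starting at position 0; cut i is where theta^(n)(u_i)
   starts. *)
Definition is_image (n : nat) (u : fullshift (A n.+1)) (v : fullshift (A n)) :
    Prop :=
  exists cut : int -> int, cut 0%R = 0%R /\
    forall i, cut (i + 1)%R = (cut i + (size (theta n (u i)))%:Z)%R /\
              word v (cut i) (size (theta n (u i))) = theta n (u i).

Definition limit_word (x : fullshift (A 0)) : Prop :=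
  exists u : forall n, fullshift (A n),
    [/\ u 0 = x, forall n, subshift (u n) &
        forall n, is_image (u n.+1) (u n)].

End DirectiveSequence.

Definition period (q : nat -> nat) (n : nat) : nat := \prod_(i < n) q i.

Record torsion_free (A : nat -> finType) (q : nat -> nat)
    (theta : directive A) : Prop := TorsionFree {
  tf_length : constant_length theta q;
  tf_gt1 : forall N, exists2 n, N <= n & 1 < q n;
  tf_minimal : forall n, minimal (@subshift A theta n);
  tf_aperiodic : aperiodic (@subshift A theta 0);
  tf_prime : forall r k, prime r -> r %| q k ->
    forall N, exists2 n, N <= n & r %| q n }.

(* The inverse limit of the Z/p_n Z, each residue class being represented by
   its member in {0, ..., p_n - 1}, as a subset of a product of discrete
   spaces. *)
Definition odometer_space := prod_topology (fun _ : nat => nat).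

Definition odometer (q : nat -> nat) : set odometer_space :=
  [set z | forall n,
     z n < period q n /\ z n.+1 = z n %[mod period q n]].

Definition odometer_succ (q : nat -> nat) (z : odometer_space) :
    odometer_space :=
  fun n => (z n).+1 %% period q n.

Definition odometer0 : odometer_space := fun _ => 0.

(* Only the restriction of pi to X is meaningful. *)
Record factor_map (T : choiceType) (X : set (fullshift T)) (q : nat -> nat)
    (pi : fullshift T -> odometer_space) : Prop := FactorMap {
  fm_continuous : {within X, continuous pi};
  fm_image : pi @` X = odometer q;
  fm_equivariant : forall x, X x -> pi (shift x) = odometer_succ q (pi x) }.

Definition tiling_factor_map (A : nat -> finType) (q : nat -> nat)
    (theta : directive A) (pi : fullshift (A 0) -> odometer_space) : Prop :=
  factor_map (@subshift A theta 0) q pi /\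
  exists2 u, limit_word theta u & pi u = odometer0.

Section Injectivisation.
Variables (A : nat -> finType) (theta : directive A).

Definition eta_of (n : nat) (B : finType) (tau : A n -> B) :
  A n.+1 -> seq B := fun a => map tau (theta _ a).

(* The pair (B_n, tau_n).  The quotient B_(n+1) of A_(n+1) by
   eta^(n)(a) = eta^(n)(a') is realised as the set of values of eta^(n). *)
Fixpoint hat_data (n : nat) : {B : finType & A n -> B} :=
  match n return {B : finType & A n -> B} with
  | 0 => existT (fun B : finType => A 0 -> B) (A 0) id
  | n'.+1 =>
      let eta := eta_of (projT2 (hat_data n')) in
      existT (fun B : finType => A n'.+1 -> B) (seq_sub (codom eta))
        (fun a => SeqSub (codom_f eta a))
  end.

Definition hat_alphabet (n : nat) : finType := projT1 (hat_data n).

Definition hat_tau (n : nat) : A n -> hat_alphabet n := projT2 (hat_data n).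

Definition hat_mor (n : nat) (b : hat_alphabet n.+1) : seq (hat_alphabet n) :=
  ssval b.

Lemma hat_morE (n : nat) (a : A n.+1) :
  hat_mor (hat_tau a) = map (@hat_tau n) (theta _ a).
Proof. by []. Qed.

Lemma hat_tau_eq (n : nat) (a a' : A n.+1) :
  hat_tau a = hat_tau a' <->
  map (@hat_tau n) (theta _ a) = map (@hat_tau n) (theta _ a').
Proof.
by split=> [e|e]; [rewrite -!hat_morE e | apply: val_inj].
Qed.

Lemma hat_tau_surj (n : nat) (b : hat_alphabet n) : exists a, hat_tau a = b.
Proof.
case: n b => [|n] b; first by exists b.
by have /codomP[a e] := ssvalP b; exists a; apply: val_inj; rewrite /= e.
Qed.

Lemma hat_mor_neq0 (n : nat) (b : hat_alphabet n.+1) : hat_mor b != [::].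
Proof.
have [a <-] := hat_tau_surj b; rewrite hat_morE -size_eq0 size_map size_eq0.
exact: mor_neq0.
Qed.

Definition injectivisation : directive hat_alphabet :=
  Directive hat_mor_neq0.

End Injectivisation.

(* The letters in column j of theta^[m, m + k); onth is Some-valued for
   j < p_(m+k) / p_m. *)
Definition column_card (A : nat -> finType) (theta : directive A)
    (m k j : nat) : nat :=
  #|codom (fun a : A (k + m) => onth (@compose A theta m k a) j)|.

(* c(theta, m), with n = k.+1 + m ranging over all n > m. *)
Definition column_inf (A : nat -> finType) (q : nat -> nat)
    (theta : directive A) (m : nat) : nat :=
  infimum 0 [set c | exists k j,
    j < period q (k.+1 + m) %/ period q m /\ c = column_card theta m k.+1 j].

Definition injective_column_number (A : nat -> finType) (q : nat -> nat)
    (theta : directive A) : nat :=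
  lim (column_inf q theta m @[m --> \oo]).

Definition naive_column_number (A : nat -> finType) (q : nat -> nat)
    (theta : directive A) : nat :=
  if `[< injective_letters theta >] then injective_column_number q theta
  else injective_column_number q (injectivisation theta).

(* Main.v *)
Require Import Defs.
From mathcomp Require Import all_boot all_order all_algebra.
From mathcomp Require Import all_classical topology zify.

(* Write p_n for the periods and Y_n for the set of theta^[0,n)(u), u in X^(n).
   Minimality of X^(n) forces the n-th coordinate of the given factor map to be
   constant on Y_n, and minimality of X makes the p_n first shifts of Y_n cover
   X; hence the fibre over z is the decreasing intersection of the compact sets
   shift^(z_n) Y_n.
   Two letters of A_m are identified in the injectivisation exactly when
   theta^[0,m) takes the same value on both, so the column number counts the
   theta^[0,m)-words that occur in a column of theta^[0,n).
   - Fix m with c(m) maximal.  The block of length p_m at position -z_m takes at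
     least c values on every shift^(z_n) Y_n; if the fibre had fewer than c
     points, the points of shift^(z_n) Y_n with a block not occurring in the
     fibre would form decreasing nonempty compact sets, and a common point
     would lie in the fibre.
   - Stacking columns that attain the infimum, chosen away from both ends so
     that the blocks exhaust Z, gives the digits of a z whose fibre shows at
     most c words on arbitrarily large windows. *)

Set Implicit Arguments.
Unset Strict Implicit.
Unset Printing Implicit Defensive.

Import Order.TTheory GRing.Theory Num.Theory.

Local Open Scope classical_set_scope.
Local Open Scope card_scope.

(** * Compactness of the full shift *)

Definition agree (T : choiceType) (l : nat) (x y : fullshift T) : Prop :=
  forall i : int, `|i|%N < l -> x i = y i.

Lemma nbhs_agree (T : choiceType) (x : fullshift T) l :
  nbhs x [set y | agree l x y].
Proof.
have near1 i : nbhs x [set y : fullshift T | x i = y i].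
  have := @proj_continuous int (fun=> discrete_topology T) i x.
  move=> /(_ [set t | x i = t]); apply.
  by apply: filterS (discrete_set1 _) => t /= ->.
elim: l => [|l IHl].
  exact: (@filterS _ _ (nbhs_filter x) setT _ _ filterT).
have := @filterI _ _ (nbhs_filter x) _ _ (near1 l%:Z%R) (near1 (- l%:Z)%R).
move=> /(@filterI _ _ (nbhs_filter x) _ _ IHl).
apply: filterS => y [/= agr [e1 e2]] i; rewrite ltnS leq_eqVlt.
case/orP=> [/eqP il|]; last exact: agr.
by have [->|->] : i = l%:Z%R \/ i = (- l%:Z)%R by lia.
Qed.

Lemma closed_agree (T : choiceType) (C : set (fullshift T)) l :
  (forall x y, agree l x y -> C y -> C x) -> closed C.
Proof.
by move=> HC x /(_ _ (nbhs_agree x l))[y [Cy agr]]; exact: HC agr Cy.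
Qed.

Lemma agree_continuous (T U : choiceType) (f : fullshift T -> fullshift U) :
  (forall i, exists l, forall x y, agree l x y -> f x i = f y i) ->
  continuous f.
Proof.
move=> Hf x; apply/cvg_sup; first exact: fmap_filter (nbhs_filter x).
move=> i.
apply/cvg_image; first exact: fmap_filter (nbhs_filter x).
  by rewrite eqEsubset; split=> // t _; exists (fun=> t).
have [l Hl] := Hf i.
(* Constant sequences make evaluation at [i] onto, so [V] is the image of its own preimage under
   it. *)
move=> V nV; exists [set y : fullshift U | V (y i)].
  apply: filterS (nbhs_agree x l) => y agr /=; rewrite -(Hl _ _ agr).
  exact: nbhs_singleton nV.
by rewrite eqEsubset; split=> [t [y Vy <-]//|t Vt]; exists (fun=> t).
Qed.

Lemma fullshift_hausdorff (T : choiceType) : hausdorff_space (fullshift T).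
Proof.
apply: hausdorff_product => _; exact: discrete_hausdorff.
Qed.

Lemma fullshift_compact (T : finType) : compact [set: fullshift T].
Proof.
have Tc : compact [set: discrete_topology T].
  by apply: finite_compact; exact: (@finite_finset T).
have := @tychonoff int (fun=> discrete_topology T) (fun=> setT) (fun=> Tc).
by congr compact; apply/seteqP.
Qed.

Lemma closed_image (T U : finType) (f : fullshift T -> fullshift U) C :
  continuous f -> closed C -> closed (f @` C).
Proof.
move=> fc Cc; apply: compact_closed; first exact: fullshift_hausdorff.
apply: continuous_compact; first exact: continuous_subspaceT.
exact: subclosed_compact Cc (@fullshift_compact T) _.
Qed.

(** By compactness the filter generated by the [C n] has a cluster point, which lies in each of them
    because they are closed. *)
Lemma nested_closed (T : finType) (C : nat -> set (fullshift T)) :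
  (forall n, closed (C n)) -> (forall n, C n.+1 `<=` C n) ->
  (forall n, C n !=set0) -> exists x, forall n, C n x.
Proof.
move=> Ccl Cdec C0.
have Cle m n : m <= n -> C n `<=` C m.
  move=> /subnK <-; elim: (n - m) => // k IH; exact: subset_trans (Cdec _) IH.
have FF : ProperFilter (filter_from [set: nat] C).
  apply: filter_from_proper => //; apply: filter_from_filter; first by exists 0.
  move=> i j _ _; exists (maxn i j) => // x Cx.
  by split; apply: Cle Cx; rewrite ?leq_maxl ?leq_maxr.
have [|x [_ clx]] := @fullshift_compact T _ FF; first exact: filterT.
exists x => n; apply: Ccl => V nV; apply: clx => //; by exists n.
Qed.

(** Two distinct points differ at some coordinate, and finitely many pairs leave one window that
    serves all. Points of a finite part of a fibre are thus told apart by their words on a large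
    window. *)
Lemma agree_separates (T : choiceType) (s : seq (fullshift T)) :
  exists l, {in s &, forall x y, agree l x y -> x = y}.
Proof.
have pair (x y : fullshift T) : exists l, agree l x y -> x = y.
  have [->|ne] := pselect (x = y); first by exists 0.
  have [i xi] : exists i, x i <> y i.
    apply: contrapT => H; apply: ne; apply: funext => i.
    by apply: contrapT => h; apply: H; exists i.
  by exists `|i|%N.+1 => /(_ i (leqnn _)).
have one (x : fullshift T) : exists l, {in s, forall y, agree l x y -> x = y}.
  elim: s => [|y s [l IH]]; first by exists 0.
  have [l' Hl'] := pair x y; exists (maxn l l') => t; rewrite inE.
  case/orP=> [/eqP ->|ts] H; first by apply: Hl' => i il; apply: H; lia.
  by apply: IH => // i il; apply: H; lia.
have [f Hf] := choice one.
exists (\max_(x <- s) f x) => x y xs ys H; apply: (Hf x y ys) => i il.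
by apply: H; apply: leq_trans il (leq_bigmax_seq _ xs _).
Qed.

(** * Words and blocks *)

Lemma flatten_map_flatten (S T : Type) (f : S -> seq T) (ss : seq (seq S)) :
  flatten (map f (flatten ss)) = flatten [seq flatten (map f s) | s <- ss].
Proof. by elim: ss => //= s ss IH; rewrite map_cat flatten_cat IH. Qed.

Lemma size_flatten_map (S T : Type) (f : S -> seq T) L (s : seq S) :
  (forall x, size (f x) = L) -> size (flatten (map f s)) = size s * L.
Proof.
by move=> fL; elim: s => //= x s IH; rewrite size_cat fL IH mulSn.
Qed.

Lemma nth_flatten_map (S T : Type) (x0 : S) (y0 : T) (f : S -> seq T) L s j :
  (forall x, size (f x) = L) -> j < size s * L ->
  nth y0 (flatten (map f s)) j = nth y0 (f (nth x0 s (j %/ L))) (j %% L).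
Proof.
move=> fL; elim: s j => [|x s IH] j /=; first by rewrite mul0n.
rewrite mulSn nth_cat fL => jlt.
have [jL|Lj] := ltnP j L; first by rewrite divn_small // modn_small.
rewrite IH; last by rewrite ltn_subLR.
have L0 : 0 < L.
  by case: L jlt Lj {fL IH} => //; rewrite muln0.
rewrite -[j in RHS](subnK Lj) divnDr // divnn L0 addn1 /=.
by rewrite modnDr.
Qed.

Lemma infix_flatten_map (S T : eqType) (f : S -> seq T) (s t : seq S) :
  infix s t -> infix (flatten (map f s)) (flatten (map f t)).
Proof.
case/infixP=> [p [r ->]]; rewrite !map_cat !flatten_cat.
by rewrite infix_catl // prefix_infix // prefix_prefix.
Qed.

Section Words.
Variable T : choiceType.
Implicit Types x y : fullshift T.

Lemma iter_shiftE k x i : iter k (@shift T) x i = x (i + k%:Z)%R.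
Proof.
elim: k x i => [|k IH] x i /=; first by rewrite addr0.
by rewrite /shift IH; congr x; lia.
Qed.

Lemma word_cat x i l1 l2 :
  word x i (l1 + l2) = word x i l1 ++ word x (i + l1%:Z)%R l2.
Proof.
rewrite /word /mkseq iotaD map_cat add0n; congr cat.
rewrite -[in LHS](addn0 l1) iotaDl -map_comp; apply: eq_map => j /=.
by congr x; lia.
Qed.

Lemma infix_word x i l i' l' :
  (i' <= i)%R -> (i + l%:Z <= i' + l'%:Z)%R ->
  infix (word x i l) (word x i' l').
Proof.
move=> h1 h2.
have -> : l' =
    (`|i - i'|%N + (l + `|(i' + l'%:Z - (i + l%:Z))%R|%N))%N by lia.
rewrite !word_cat.
have -> : (i' + `|i - i'|%:Z)%R = i by lia.
by rewrite infix_catl // prefix_infix // prefix_prefix.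
Qed.

Lemma word_eq x y i i' l :
  (forall j, j < l -> x (i + j%:Z)%R = y (i' + j%:Z)%R) ->
  word x i l = word y i' l.
Proof.
move=> xy; apply: (@eq_from_nth _ (x 0%R)); rewrite ?size_mkseq // => j jl.
by rewrite !nth_mkseq // xy.
Qed.

Lemma word_shift k x i l :
  word (iter k (@shift T) x) i l = word x (i + k%:Z)%R l.
Proof. by apply: word_eq => j _; rewrite iter_shiftE; congr x; lia. Qed.

Lemma agree_word x y i l :
  agree (`|i|%N + l).+1 x y -> word x i l = word y i l.
Proof. by move=> xy; apply: word_eq => j jl; apply: xy; lia. Qed.

End Words.

(** * Constant-length morphisms acting on bi-infinite sequences *)

Section Blow.
Variables (S T : choiceType).

(** The image of [u] under the morphism sending a to f 0 a ... f (L-1) a, with the image of [u 0]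
    starting at position 0. *)
Definition blow (L : nat) (f : nat -> S -> T) (u : fullshift S) : fullshift T :=
  fun i => f `|(i %% L)%Z|%N (u (i %/ L)%Z).

Lemma blowE L f u (a : int) j :
  j < L -> blow L f u (a * L%:Z + j%:Z)%R = f j (u a).
Proof.
move=> jL; rewrite /blow modzMDl divzMDl; last by lia.
by rewrite divz_small ?modz_small ?addr0 //; lia.
Qed.

Lemma decomp L (i : int) : 0 < L ->
  exists a j, j < L /\ i = (a * L%:Z + j%:Z)%R.
Proof.
move=> L0; exists (i %/ L)%Z, `|(i %% L)%Z|%N.
have h := @modz_ge0 i L; have h' := @ltz_pmod i L.
by split; [lia | rewrite {1}(divz_eq i L); lia].
Qed.

Lemma blow_shift L f u : 0 < L ->
  iter L (@shift T) (blow L f u) = blow L f (shift u).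
Proof.
move=> L0; apply: funext => i; rewrite iter_shiftE.
have [a [j [jL ->]]] := decomp i L0.
have -> : (a * L%:Z + j%:Z + L%:Z = (a + 1) * L%:Z + j%:Z)%R by lia.
by rewrite !blowE.
Qed.

Lemma word_blow L f u (a : int) l : 0 < L ->
  word (blow L f u) (a * L%:Z)%R (l * L) =
  flatten [seq mkseq (f^~ b) L | b <- word u a l].
Proof.
move=> L0; elim: l a => [|l IH] a //.
rewrite mulSn word_cat -addn1 addnC word_cat map_cat flatten_cat.
rewrite -IH /= cats0; congr (_ ++ word _ _ _); last by lia.
apply: (@eq_from_nth _ (f 0 (u a))); rewrite ?size_mkseq // => j jl.
by rewrite !nth_mkseq // blowE // addr0.
Qed.

Lemma blow_continuous L f : continuous (blow L f).
Proof.
apply: agree_continuous => i; exists (`|(i %/ L)%Z|%N).+1 => x y xy.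
by rewrite /blow xy.
Qed.

End Blow.

Lemma shift_continuous (T : choiceType) k : continuous (iter k (@shift T)).
Proof.
apply: agree_continuous => i; exists (`|i|%N + k).+1 => x y xy.
by rewrite !iter_shiftE xy //; lia.
Qed.

Lemma blow_blow (R S T : choiceType) L M (f : nat -> S -> T)
    (g : nat -> R -> S) u :
  0 < L -> 0 < M ->
  blow L f (blow M g u) =
  blow (L * M) (fun j a => f (j %% L) (g (j %/ L) a)) u.
Proof.
move=> L0 M0; apply: funext => i.
have [b [j [jL ->]]] := decomp i L0; rewrite blowE //.
have [a [k [kM ->]]] := decomp b M0; rewrite blowE //.
have -> : ((a * M%:Z + k%:Z) * L%:Z + j%:Z =
    a * (L * M)%N%:Z + (k * L + j)%N%:Z)%R by nia.
rewrite blowE; last by nia.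
by rewrite modnMDl modn_small // divnMDl // divn_small // addn0.
Qed.

(** * Compositions of the morphisms *)

Section Composition.
Variables (A : nat -> finType) (theta : directive A).

(** [k2 + (k + m)] and [k2 + k + m] are not convertible, so letters are transported along the
    equality of indices. *)
Definition cast (n n' : nat) (e : n = n') (a : A n) : A n' :=
  eq_rect n (fun i => A i : Type) a n' e.

Lemma castK n n' (e : n = n') (a : A n') : cast e (cast (esym e) a) = a.
Proof. by case: _ / e a. Qed.

Lemma mor_cast n n' (e : n = n') (e' : n.+1 = n'.+1) (a : A n.+1) :
  theta n' (cast e' a) = map (cast e) (theta n a).
Proof.
case: _ / e e' => e'; rewrite (eq_irrelevance e' erefl) /=.
by rewrite map_id_in.
Qed.

Lemma compose_cat m k k2 (e : k2 + (k + m) = k2 + k + m) a :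
  @compose A theta m (k2 + k) (cast e a) =
  flatten (map (@compose A theta m k) (@compose A theta (k + m) k2 a)).
Proof.
elim: k2 e a => [|k2 IH] e a /=.
  by rewrite (eq_irrelevance e erefl) /= cats0.
rewrite (mor_cast (addnA k2 k m)) -map_comp flatten_map_flatten -map_comp.
by congr flatten; apply: eq_map => b; exact: IH.
Qed.

Definition language n : set (seq (A n)) :=
  [set w | exists k, exists a : A (k.+1 + n),
     infix w (@compose A theta n k.+1 a)].

Lemma language_infix n (v w : seq (A n)) :
  infix v w -> language w -> language v.
Proof. by move=> vw [k [a wa]]; exists k, a; exact: infix_trans vw wa. Qed.

Lemma language_mor n (w : seq (A n.+1)) :
  language w -> language (flatten (map (@mor A theta n) w)).
Proof.
case=> k [a wa]; exists (k + 1), (cast (addnA k.+1 1 n) a).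
have E : @compose A theta n 1 =1 @mor A theta n.
  by move=> b /=; rewrite -[RHS]flatten_seq1.
rewrite (@compose_cat n 1 k.+1) (eq_map E).
exact: (infix_flatten_map (@mor A theta n) wa).
Qed.

Lemma subshift_window n (x : fullshift (A n)) :
  (forall l, language (word x (- l%:Z)%R (l + l))) -> @subshift A theta n x.
Proof.
move=> H i l; apply: language_infix (H (`|i|%N + l)).
by apply: infix_word; lia.
Qed.

Lemma subshift_closed n : closed (@subshift A theta n).
Proof.
have -> : @subshift A theta n =
    \bigcap_(p in [set: int * nat]) [set x | language (word x p.1 p.2)].
  apply/seteqP; split=> x Xx => [[i l] _|i l]; first exact: Xx.
  exact: (Xx (i, l)).
apply: closed_bigI => -[i l] _ /=.
by apply: (@closed_agree _ _ (`|i|%N + l).+1) => x y /agree_word /= ->.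
Qed.

Lemma subshift_iter n k x :
  @subshift A theta n x -> @subshift A theta n (iter k (@shift _) x).
Proof. by move=> Xx i l; rewrite word_shift; exact: Xx. Qed.

(** The conditions on central windows are closed and grow stronger with the window, so compactness
    gives a point of [C] satisfying all of them. *)
Lemma subshift_limit n (C : set (fullshift (A n))) : closed C ->
  (forall l, exists2 x, C x & language (word x (- l%:Z)%R (l + l))) ->
  exists2 x, C x & @subshift A theta n x.
Proof.
move=> Ccl H.
have [||l|x Hx] := @nested_closed (A n)
    (fun l => C `&` [set x | language (word x (- l%:Z)%R (l + l))]).
- move=> l; apply: closedI => //.
  apply: (@closed_agree _ _ (`|(- l%:Z)%R|%N + (l + l)).+1) => x y.
  by move=> /agree_word /= ->.
- move=> l x [Cx Lx]; split=> //; apply: language_infix Lx.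
  by apply: infix_word; lia.
- by have [x Cx Lx] := H l; exists x.
by exists x; [have [] := Hx 0 | apply: subshift_window => l; have [] := Hx l].
Qed.

End Composition.

(** * Columns and images of points for a constant-length sequence *)

Section ConstantLength.
Variables (A : nat -> finType) (q : nat -> nat) (theta : directive A).
Hypothesis hq : constant_length theta q.
Variable d : forall n, A n.

(** The length of theta^[n,n+k), that is, p_(n+k) / p_n. *)
Definition len n k := \prod_(i < k) q (i + n).

Lemma q_gt0 n : 0 < q n.
Proof.
by rewrite -(hq (d n.+1)) lt0n size_eq0; exact: mor_neq0.
Qed.

Lemma len0 n : len n 0 = 1. Proof. by rewrite /len big_ord0. Qed.

Lemma lenS n k : len n k.+1 = len n k * q (k + n).
Proof. by rewrite /len big_ord_recr. Qed.

Lemma len_gt0 n k : 0 < len n k.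
Proof. by rewrite prodn_gt0 // => i; exact: q_gt0. Qed.

Lemma len_add n k k2 : len n (k2 + k) = len n k * len (k + n) k2.
Proof.
elim: k2 => [|k2 IH]; first by rewrite len0 muln1.
by rewrite addSn !lenS IH -mulnA addnA.
Qed.

Lemma periodS n : period q n.+1 = period q n * q n.
Proof. by rewrite /period big_ord_recr. Qed.

Lemma period_gt0 n : 0 < period q n.
Proof. by rewrite prodn_gt0 // => i; exact: q_gt0. Qed.

Lemma period_len n k : period q (k + n) = period q n * len n k.
Proof.
elim: k => [|k IH]; first by rewrite len0 muln1.
by rewrite addSn periodS lenS IH mulnA.
Qed.

Lemma size_compose n k (a : A (k + n)) :
  size (@compose A theta n k a) = len n k.
Proof.
elim: k a => [|k IH] a; first by rewrite len0.
by rewrite /= (size_flatten_map _ IH) hq lenS mulnC.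
Qed.

Definition column n k j (a : A (k + n)) : A n :=
  nth (d n) (@compose A theta n k a) j.

Lemma col_add n k k2 j (e : k2 + (k + n) = k2 + k + n) a : j < len n (k2 + k) ->
  @column n (k2 + k) j (cast e a) =
  @column n k (j %% len n k) (@column (k + n) k2 (j %/ len n k) a).
Proof.
move=> jl; rewrite /column compose_cat.
rewrite (nth_flatten_map (d (k + n)) _ (@size_compose n k)) //.
by rewrite size_compose mulnC -len_add.
Qed.

Definition step n (j : nat) (a : A n.+1) : A n := nth (d n) (theta n a) j.

Lemma col_step n k j a : j < len n k.+1 ->
  @column n k.+1 j a =
  @column n k (j %% len n k) (@step (k + n) (j %/ len n k) a).
Proof.
move=> jl; rewrite /column /=.
rewrite (nth_flatten_map (d (k + n)) _ (@size_compose n k)) //.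
by rewrite hq mulnC -lenS.
Qed.

(** The point theta^(n)(u), as a function where [is_image] is a relation. *)
Definition lower n (u : fullshift (A n.+1)) : fullshift (A n) :=
  blow (q n) (@step n) u.

Lemma mkseq_step n (a : A n.+1) : mkseq (fun j => step j a) (q n) = theta n a.
Proof. by rewrite -(hq a) mkseq_nth. Qed.

Lemma lower_subshift n u :
  @subshift A theta n.+1 u -> @subshift A theta n (lower u).
Proof.
move=> Xu; apply: subshift_window => l.
have H := language_mor (Xu (- l%:Z)%R (l + l)).
rewrite -(eq_map (@mkseq_step n)) -word_blow ?q_gt0 // in H.
(* As [q n] is positive, the window [-l, l) lies inside [-l q_n, l q_n), which the image of the word
   of [u] on [-l, l) covers. *)
by apply: language_infix H; apply: infix_word; have := q_gt0 n; nia.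
Qed.

(* [base n j a] is the j-th letter of theta^[0,n)(a), for j < p_n. *)
Fixpoint base n : nat -> A n -> A 0 :=
  match n return nat -> A n -> A 0 with
  | 0 => fun _ a => a
  | n'.+1 => fun j a =>
      @base n' (j %% period q n') (@step n' (j %/ period q n') a)
  end.

(** Associativity of composition, read at one position. Both [base] and [column] peel off the
    topmost morphism, hence the induction on [k]. *)
Lemma base_col n k j a : j < period q (k + n) ->
  @base (k + n) j a =
  @base n (j %% period q n) (@column n k (j %/ period q n) a).
Proof.
have p0 := period_gt0 n; elim: k j a => [|k IH] j a jl /=.
  by rewrite divn_small // modn_small.
have pkn : period q (k + n) = len n k * period q n by rewrite period_len mulnC.
rewrite IH ?ltn_pmod ?period_gt0 // modn_dvdm; last by rewrite pkn dvdn_mull.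
rewrite col_step; last first.
  rewrite ltn_divLR // lenS -mulnA [_ * period _ _]mulnC mulnA -pkn.
  by rewrite -periodS.
rewrite pkn -divnMA [period q n * _]mulnC; congr (base _ (column _ _)).
by rewrite -modn_divl.
Qed.

(** The point theta^[0,n)(u). *)
Definition expand n (u : fullshift (A n)) : fullshift (A 0) :=
  blow (period q n) (@base n) u.

Lemma expand0 (u : fullshift (A 0)) : expand u = u.
Proof.
apply: funext => i; rewrite /expand /blow /period big_ord0 /=.
by congr u; rewrite divz1.
Qed.

Lemma expandS n (u : fullshift (A n.+1)) : expand u = expand (lower u).
Proof. by rewrite /expand /lower blow_blow ?q_gt0 ?period_gt0 // -periodS. Qed.

Lemma expand_subshift n u :
  @subshift A theta n u -> @subshift A theta 0 (expand u).
Proof.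
elim: n u => [|n IH] u Xu; first by rewrite expand0.
by rewrite expandS; apply: IH; exact: lower_subshift.
Qed.

(** Constant length forces [cut i] to be [i * q n], by induction in both directions from
    [cut 0 = 0]. *)
Lemma lower_of_image n (u : fullshift (A n.+1)) v :
  is_image theta u v -> v = lower u.
Proof.
case=> cut [cut0 Hcut].
have q0 := q_gt0 n.
have cutE i : cut i = (i * (q n)%:Z)%R.
  have up (m : nat) : cut m%:Z%R = (m%:Z * (q n)%:Z)%R.
    elim: m => [|m IH]; first by rewrite cut0 mul0r.
    by have [+ _] := Hcut m%:Z%R; rewrite hq IH -addn1 PoszD => ->; lia.
  have dn (m : nat) : cut (- m%:Z)%R = (- m%:Z * (q n)%:Z)%R.
    elim: m => [|m IH]; first by rewrite cut0 mul0r.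
    have [+ _] := Hcut (- (m.+1)%:Z)%R; rewrite hq.
    by have -> : (- (m.+1)%:Z + 1 = - m%:Z)%R; [lia | rewrite IH; lia].
  by have [->|->] : i = `|i|%N%:Z%R \/ i = (- `|i|%N%:Z)%R by lia.
apply: funext => i; have [a [j [jq ->]]] := decomp i q0.
rewrite /lower blowE //; have [_] := Hcut a; rewrite hq cutE => e.
by rewrite /step -e nth_mkseq.
Qed.

End ConstantLength.

(** * Fibres of the tiling factor map *)

Section Tiling.
Variables (A : nat -> finType) (q : nat -> nat) (theta : directive A).
Hypothesis hq : constant_length theta q.
Variable d : forall n, A n.
Hypothesis hmin : forall n, minimal (@subshift A theta n).
Variable pi : fullshift (A 0) -> odometer_space.
Hypothesis hpi : tiling_factor_map q theta pi.

Local Notation X n := (@subshift A theta n).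
Local Notation p := (period q).
Local Notation image0 := (@expand A q theta d _).

Let p_gt0 n : 0 < p n := period_gt0 hq d n.

(** The set shift^i Y_n, where Y_n is theta^[0,n)(X^(n)). *)
Definition tile n i : set (fullshift (A 0)) :=
  [set iter i (@shift _) (image0 u) | u in X n].

Lemma tile_closed n i : closed (tile n i).
Proof.
have -> : tile n i = iter i (@shift _) @` (@expand A q theta d n @` X n).
  apply/seteqP; split=> [_ [u Xu <-]|_ [_ [u Xu <-] <-]]; last by exists u.
  by exists (image0 u) => //; exists u.
apply: closed_image; first exact: shift_continuous.
by apply: closed_image; [exact: blow_continuous | exact: subshift_closed].
Qed.

Lemma tile_subshift n i : tile n i `<=` X 0.
Proof.
move=> _ [u Xu <-]; apply: subshift_iter; exact: (expand_subshift hq).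
Qed.

Lemma shift_expand n (u : fullshift (A n)) i :
  iter (i + p n) (@shift _) (image0 u) = iter i (@shift _) (image0 (shift u)).
Proof. by rewrite iterD blow_shift. Qed.

(** The union of these tiles is closed, nonempty and shift-invariant, hence all of X by
    minimality. *)
Lemma tile_cover n x : X 0 x -> exists2 i, i < p n & tile n i x.
Proof.
move=> Xx; have [_ /(_ (\bigcup_(i in `I_(p n)) tile n i))] := hmin 0.
case=> [||_ [y [i ip ty] <-]||].
- by apply: closed_bigcup => [|i _]; [exact: finite_II | exact: tile_closed].
- by move=> y [i _]; exact: tile_subshift.
- have [ipS|ipS] := ltnP i.+1 (p n).
    by exists i.+1 => //; case: ty => u Xu <-; exists u.
  (* Wrap-around: shifting theta^[0,n)(u) by p_n gives theta^[0,n)(shift u), which is back in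
     Y_n. *)
  exists 0; first exact: p_gt0.
  case: ty => u Xu <-; exists (shift u); first exact: (subshift_iter 1).
  rewrite -[RHS]/(iter i.+1 (@shift _) (image0 u)).
  have -> : i.+1 = 0 + p n by move: ip ipS => /=; lia.
  by rewrite shift_expand.
- have [u Xu] := (hmin n).1 => /seteqP[+ _].
  move=> /(_ (image0 u)) []; exists 0; first exact: p_gt0.
  by exists u.
by move=> e; move: Xx; rewrite -e => -[i ip ti]; exists i.
Qed.

Lemma pi_odometer x : X 0 x -> odometer q (pi x).
Proof. by move=> Xx; rewrite -(fm_image hpi.1); exists x. Qed.

Lemma pi_iter x i n : X 0 x -> pi (iter i (@shift _) x) n = (pi x n + i) %% p n.
Proof.
move=> Xx; elim: i => [|i IH].
  by rewrite addn0 modn_small //; have [] := pi_odometer Xx n.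
rewrite iterS (fm_equivariant hpi.1); last exact: subshift_iter.
by rewrite /odometer_succ IH -addn1 modnDml addn1 -addnS.
Qed.

Lemma pi_near x n : X 0 x -> nbhs x [set y | X 0 y -> pi y n = pi x n].
Proof.
move=> Xx.
have c := fm_continuous hpi.1.
have /(_ [set t | t = pi x n]) := @proj_continuous nat (fun=> nat) n (pi x).
move=> /(_ (discrete_set1 _)) /(c x).
by rewrite /= /nbhs /= -(nbhs_subspace_in Xx).
Qed.

(* The u with pi(image0 u)_n = 0 form a closed shift-invariant set, nonempty
   because of the limit word; so it is all of X^(n). *)
Lemma pi_expand n u : X n u -> pi (image0 u) n = 0.
Proof.
have [_ [x [v [v0 Xv vim]] pix]] := hpi.
(* Following the chain of preimages, the limit word is theta^[0,m)(v m) for every [m]. *)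
have xE m : x = image0 (v m).
  rewrite -v0; elim: m => [|m ->]; first by rewrite (expand0 q theta d).
  by rewrite (expandS hq) -(lower_of_image hq d (vim m)).
move=> Xu; have [_ /(_ [set u | X n u /\ pi (image0 u) n = 0])] := hmin n.
case=> [||_ [w [Xw piw] <-]||].
- move=> w clw.
  have Xw : X n w.
    by apply: subshift_closed => V /clw [y [[Xy _] Vy]]; exists y.
  split=> //.
  have /(@blow_continuous _ _ (p n) (@base A q theta d n) w) :=
    pi_near n (expand_subshift hq d Xw).
  move=> /clw [y [[Xy piy]]] /= <- //; exact: (expand_subshift hq).
- by move=> w [].
(* Passing from [w] to [shift w] shifts the image by p_n, which adds 0 modulo p_n. *)
- split; first exact: (subshift_iter 1).
  rewrite -[expand _ _ _ _]/(iter 0 (@shift _) _) -shift_expand.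
  rewrite pi_iter; last exact: (expand_subshift hq).
  by rewrite piw !add0n modnn.
- move=> /seteqP[/(_ (v n))[]]; split; first exact: Xv.
  by rewrite -(xE n) pix.
by move=> /seteqP[_ /(_ u Xu)[]].
Qed.

Lemma tile_pi n i x : tile n i x -> pi x n = i %% p n.
Proof.
by move=> [u Xu <-]; rewrite pi_iter ?pi_expand //; exact: (expand_subshift hq).
Qed.

Lemma odometer_mod z n k : odometer q z -> z (k + n) %% p n = z n.
Proof.
move=> oz; elim: k => [|k IH]; first by rewrite modn_small //; have [] := oz n.
have [_ e] := oz (k + n).
have dv : p n %| p (k + n) by rewrite period_len dvdn_mulr.
by rewrite -IH addSn -(modn_dvdm _ dv) e modn_dvdm.
Qed.

(** Tiles determine the coordinates of [pi], and every point of X lies in the tile indexed by its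
    own coordinate. Starting at level [m] loses nothing, since higher coordinates of [z] determine
    lower ones. *)
Lemma fibreP z x m : odometer q z ->
  (forall k, tile (k + m) (z (k + m)) x) <->
  (X 0 `&` pi @^-1` [set z]) x.
Proof.
move=> oz; split=> [tx|[Xx /= pix] k]; last first.
  have [i ip tix] := tile_cover (k + m) Xx.
  by have := tile_pi tix; rewrite pix modn_small // => ->.
have Xx : X 0 x by exact: tile_subshift (tx 0).
split=> //=; apply: funext => n; rewrite -(odometer_mod n m oz).
rewrite -(odometer_mod n m (pi_odometer Xx)) addnC (tile_pi (tx n)).
by rewrite modn_dvdm // [n + m]addnC period_len dvdn_mulr.
Qed.

Lemma iter_expand n (u : fullshift (A n)) i h :
  iter (i + h * p n) (@shift _) (image0 u) =
  iter i (@shift _) (image0 (iter h (@shift _) u)).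
Proof.
elim: h u => [|h IH] u; first by rewrite addn0.
by rewrite mulSn addnCA addnC shift_expand IH iterSr.
Qed.

(** The multiple of p_n contained in [i] is absorbed by shifting the point of X^(n). This makes the
    tiles along an odometer point decrease. *)
Lemma tile_mod n i x : tile n.+1 i x -> tile n (i %% p n) x.
Proof.
move=> [u Xu <-]; exists (iter (i %/ p n) (@shift _) (lower q theta d u)).
  by apply: subshift_iter; exact: (lower_subshift hq).
by rewrite -iter_expand (expandS hq) addnC -divn_eq.
Qed.

(** Undoing the shift turns the position into (i div p_n) p_n + j, which stays within the image of
    [u 0] because i < p_(k+n) and j < p_n. *)
Lemma block_expand n k i j (u : fullshift (A (k + n))) :
  i < p (k + n) -> j < p n ->
  iter i (@shift _) (image0 u) (j%:Z - (i %% p n)%N%:Z)%R =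
  @base A q theta d n j (@column A theta d n k (i %/ p n) (u 0%R)).
Proof.
move=> ip jp; rewrite iter_shiftE.
have := divn_eq i (p n) => ei.
have l : i %/ p n * p n + j < p (k + n).
  rewrite period_len [Y in _ < Y]mulnC; have : i %/ p n < len q n k.
    by rewrite ltn_divLR // mulnC -period_len.
  by move=> h; nia.
have -> : (j%:Z - (i %% p n)%N%:Z + i%:Z =
    0 * (p (k + n))%:Z + (i %/ p n * p n + j)%N%:Z)%R.
  by rewrite {2}ei; lia.
rewrite /expand blowE // (base_col hq) //.
by rewrite modnMDl divnMDl ?(modn_small jp) ?(divn_small jp) ?addn0 //.
Qed.

End Tiling.

(** * Counting points in a fibre *)

Section Counting.
Variables (A : nat -> finType) (q : nat -> nat) (theta : directive A).
Hypothesis hq : constant_length theta q.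
Hypothesis hgt1 : forall N, exists2 n, N <= n & 1 < q n.
Variable d : forall n, A n.

(** [rho] stands for the quotient map onto the injectivised alphabet, or for the identity when the
    letters are already separated. *)
Variables (B : nat -> finType) (rho : forall n, A n -> B n).

Local Notation X n := (@subshift A theta n).
Local Notation p := (period q).
Local Notation image0 := (@expand A q theta d _).
Local Notation column := (@column A theta d _ _).
Local Notation base := (@base A q theta d _).

Let p_gt0 n : 0 < p n := period_gt0 hq d n.
Let l_gt0 n k : 0 < len q n k := len_gt0 hq d n k.

Lemma len_unbounded n N : exists k, N < len q n k.+1.
Proof.
elim: N => [|N [k Nk]]; first by exists 0.
have [n' n'k q1] := hgt1 (k.+1 + n).
exists (n' - n); rewrite lenS subnK; last by lia.
have : len q n k.+1 <= len q n (n' - n).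
  have /subnK <- : k.+1 <= n' - n by lia.
  by rewrite (len_add q) leq_pmulr.
by nia.
Qed.

(* A_n may contain letters that do not occur in X^(n), but such letters cannot
   appear far from both ends of a long word theta^[n,N)(a). *)
Lemma mid_column n : exists k j, j < len q n k.+1 /\
  forall a : A (k.+1 + n), exists2 u, X n u & u 0%R = column j a.
Proof.
apply: contrapT => H.
have [||x Cx Xx] := @subshift_limit A theta n
    [set x | forall u, X n u -> u 0%R <> x 0%R]; last exact: Cx Xx _.
  by apply: (@closed_agree _ _ 1) => x y xy Cy u /Cy; rewrite xy.
move=> l; have [k lk] := len_unbounded n (l + l).
have [a Ha] : exists a : A (k.+1 + n), forall u, X n u -> u 0%R <> column l a.
  apply: contrapT => H'; apply: H; exists k, l; split; first by lia.
  move=> a; apply: contrapT => Ha; apply: H'; exists a => u Xu e.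
  by apply: Ha; exists u.
(* The word is placed with column [l] at the origin. The absolute value and the default letter only
   affect positions outside [-l, l). *)
exists (fun i => nth (d n) (@compose A theta n k.+1 a) `|(i + l%:Z)%R|%N).
  exact: Ha.
exists k, a; apply/infixP.
exists [::], (drop (l + l) (@compose A theta n k.+1 a)).
rewrite /= -[LHS](cat_take_drop (l + l)); congr cat.
have sz : size (take (l + l) (@compose A theta n k.+1 a)) = l + l.
  by rewrite size_takel // (size_compose hq) ltnW.
apply: (@eq_from_nth _ (d n)); rewrite sz ?size_mkseq // => j jl.
by rewrite nth_mkseq // nth_take //; congr nth; lia.
Qed.

Definition spread n k j := #|codom (fun a : A (k + n) => rho (column j a))|.

(** A column of the longer composition is read by applying column [i] to the letters of column [j],
    so prolonging a composition never enlarges a column. *)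
Lemma spread_add n k k2 i j : i < len q n k -> j < len q (k + n) k2 ->
  {subset
   codom (fun a : A (k2 + k + n) => rho (column (j * len q n k + i) a)) <=
   codom (fun a : A (k2 + (k + n)) => rho (column i (column j a)))}.
Proof.
move=> ik jk r /codomP[a ->].
rewrite -(castK (addnA k2 k n) a) (col_add hq); last first.
  by rewrite (len_add q); nia.
rewrite modnMDl modn_small // divnMDl // divn_small // addn0.
exact: codom_f.
Qed.

(** Prolong column [i] by a column all of whose letters occur in X^(k+m): the result still has at
    least [c] classes, more than [R] can list. *)
Lemma spread_subshift c m k i (R : seq (B m)) :
  (forall k j, j < len q m k.+1 -> c <= spread m k.+1 j) ->
  i < len q m k -> size R < c ->
  exists2 u, X (k + m) u & rho (column i (u 0%R)) \notin R.
Proof.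
move=> hc ik Rc; apply: contrapT => H.
have [k2 [j [jk mid]]] := mid_column (k + m).
have := hc (k2 + k) (j * len q m k + i).
rewrite -[(k2 + k).+1]/(k2.+1 + k) (len_add q).
have lt : j * len q m k + i < len q m k * len q (k + m) k2.+1 by nia.
move=> /(_ lt); apply/negP; rewrite -ltnNge; apply: leq_ltn_trans Rc.
apply: leq_trans (card_size R); apply: subset_leq_card.
apply/fintype.subsetP => r.
move=> /(spread_add ik jk) /codomP[a ->].
have [u Xu <-] := mid a; apply: contrapT => /negP nR; apply: H.
by exists u.
Qed.

(** Prolong by a composition of length at least 3 and use column [j] inside its second block, which
    is neither first nor last. *)
Lemma interior_column c m k j : j < len q m k.+1 -> spread m k.+1 j <= c ->
  exists k' j', [/\ 0 < j', j'.+1 < len q m k' & spread m k' j' <= c].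
Proof.
move=> jk sc; have [k2 hk2] := len_unbounded (k.+1 + m) 2.
exists (k2.+1 + k.+1), (1 * len q m k.+1 + j).
have := l_gt0 m k.+1 => l0.
rewrite (len_add q); split; [lia|nia|].
apply: leq_trans sc; apply: subset_leq_card; apply/fintype.subsetP => r.
move=> /(spread_add jk (_ : 1 < _)) => /(_ (ltnW hk2)) /codomP[a ->].
exact: codom_f.
Qed.

Hypothesis hmin : forall n, minimal (@subshift A theta n).
Variable pi : fullshift (A 0) -> odometer_space.
Hypothesis hpi : tiling_factor_map q theta pi.
Hypothesis rhoP : forall n (a b : A n),
  rho a = rho b <-> forall j, j < p n -> base j a = base j b.

Local Notation fibre z := (X 0 `&` pi @^-1` [set z]).
Local Notation tile := (tile q theta d).

Lemma no_small_fibre c m z k :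
  (forall k j, j < len q m k.+1 -> c <= spread m k.+1 j) ->
  odometer q z -> k < c -> ~ (fibre z #= `I_k).
Proof.
move=> hc oz kc Fk.
pose Rel (x : fullshift (A 0)) (a : A m) :=
  forall j, j < p m -> x (j%:Z - (z m)%:Z)%R = base j a.
(* By [rhoP] the class of [letter x] does not depend on the letter chosen. If no letter fits, the
   default merely contributes a harmless entry to [R]. *)
pose letter x := xget (d m) [set a | Rel x a].
pose s : seq (fullshift (A 0)) := finmap.enum_fset (fset_set (fibre z)).
have fF : finite_set (fibre z) by apply/finite_setP; exists k.
pose R := [seq rho (letter x) | x <- s].
have szR : size R < c by rewrite size_map (card_fset_set Fk).
pose K k := tile (k + m) (z (k + m)) `&`
  [set x | exists2 a, Rel x a & rho a \notin R].
have [l|l x [tx Ex]|l|x Kx] := @nested_closed (A 0) K.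
- apply: closedI; first exact: tile_closed.
  apply: (@closed_agree _ _ (p m + z m).+1) => x y xy [a ya nR].
  by exists a => // j jp; rewrite xy ?ya //; lia.
- split=> //; have [zl e] := oz (l + m); rewrite (modn_small zl) in e.
  by rewrite -e; exact: (tile_mod hq tx).
- have [zp _] := oz (l + m).
  have il : z (l + m) %/ p m < len q m l.
    by rewrite ltn_divLR // mulnC -period_len.
  (* The block at -z_m is governed by column z_(l+m) div p_m of the letter [u 0], and some [u] gives
     it a class outside [R]. *)
  have [u Xu nR] := spread_subshift hc il szR.
  exists (iter (z (l + m)) (@shift _) (image0 u)); split; first by exists u.
  exists (column (z (l + m) %/ p m) (u 0%R)) => // j jp.
  by rewrite -(odometer_mod m l oz) (block_expand hq).
have Fx : fibre z x.
  by apply/(fibreP hq d hmin hpi x m oz) => l; have [] := Kx l.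
have [_ [a xa /negP]] := Kx 0; apply.
apply/mapP; exists x; first by rewrite in_fset_set // inE.
apply/rhoP => j jp; rewrite -xa //.
by rewrite (@xgetI _ (d m) [set a | Rel x a] a xa).
Qed.

(** The bound is put on duplicate-free lists because finiteness of the fibre is not yet known. *)
Lemma small_fibre c M :
  (forall m, M <= m -> exists k j, j < len q m k.+1 /\ spread m k.+1 j <= c) ->
  exists2 z, odometer q z &
    forall s : seq (fullshift (A 0)), uniq s -> {in s, forall x, fibre z x} ->
      size s <= c.
Proof.
move=> hle.
(* The premise sits under the existential so that [choice] yields a total function, with dummy value
   (0, 0) below [M]. *)
have next m : exists kj : nat * nat, M <= m ->
    [/\ 0 < kj.2, kj.2.+1 < len q m kj.1 & spread m kj.1 kj.2 <= c].
  have [Mm|] := leqP M m; last by exists (0, 0).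
  have [k [j [jk sc]]] := hle m Mm.
  by have [k' [j' ?]] := interior_column jk sc; exists (k', j').
have [g Hg] := choice next.
(* [m t] and [r t] are the t-th level of the construction and z_(m t). *)
pose st := fix st t := if t is t'.+1 then
  let: (m, r) := st t' in ((g m).1 + m, r + p m * (g m).2) else (M, 0).
pose m t := (st t).1; pose r t := (st t).2.
have mS t : m t.+1 = (g (m t)).1 + m t by rewrite /m /=; case: (st t).
have rS t : r t.+1 = r t + p (m t) * (g (m t)).2.
  by rewrite /r /m /=; case: (st t).
(* The last two bounds say that the block [-r t, p_(m t) - r t) contains [-t, t]. It grows to the
   left since the chosen column is not the first, and to the right since it is not the last. *)
have inv t : [/\ M <= m t, t <= m t, t <= r t & t + r t < p (m t)].
  elim: t => [|t [Mm tm tr tp]]; first by split=> //=; rewrite add0n.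
  have [j0 jk _] := Hg _ Mm.
  have := p_gt0 (m t) => p0.
  have k0 : 0 < (g (m t)).1.
    by case: (g _).1 jk => //; rewrite len0; case: (g _).2 j0.
  by rewrite mS rS period_len; split; [lia|lia|nia|nia].
have Mm t : M <= m t by have [] := inv t.
have rp t : r t < p (m t) by have [] := inv t; lia.
have mle t : forall u, p (m t) %| p (m (u + t)).
  elim=> [//|u IH]; rewrite addSn mS period_len; exact: dvdn_mulr.
have rmod t u : r (u + t) %% p (m t) = r t.
  elim: u => [|u IH]; first by rewrite modn_small.
  rewrite addSn rS -modnDmr (eqP (dvdn_mulr _ (mle t u))).
  by rewrite addn0 IH.
have pm t : p t %| p (m t).
  have [_ tm _ _] := inv t.
  by rewrite -(subnK tm) period_len dvdn_mulr.
(* The index [n] serves as a level: n <= m n, so p_n divides p_(m n) and [r n] carries enough digits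
   for coordinate [n]. *)
pose z : odometer_space := fun n => r n %% p n.
have zm t : z (m t) = r t.
  have [_ tm _ _] := inv t.
  by have := rmod t (m t - t); rewrite (subnK tm).
have oz : odometer q z.
  move=> n; split; first by rewrite ltn_pmod.
  have dv : p n %| p n.+1 by rewrite periodS dvdn_mulr.
  rewrite /z modn_dvdm // modn_mod.
  by rewrite -(rmod n 1) modn_dvdm.
exists z => // s us Fs; have [l sep] := agree_separates s.
have [_ _ lr lp] := inv l.
set k := (g (m l)).1; set j := (g (m l)).2.
have [j0 jk sc] := Hg _ (Mm l); rewrite -/k -/j in j0 jk sc.
have zk : z (k + m l) = j * p (m l) + r l by rewrite -mS zm rS addnC mulnC.
(* On a block containing the separating window, each point of [s] shows the theta^[0,m l)-word of a
   letter in the small column [j]. *)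
have block x : exists a : A (k + m l), x \in s -> forall i, i < p (m l) ->
    x (i%:Z - (r l)%:Z)%R = base i (column j a).
  have [xs|] := boolP (x \in s); last by exists (d _).
  have [u Xu <-] := (fibreP hq d hmin hpi x (m l) oz).2 (Fs x xs) k.
  exists (u 0%R) => _ i ip.
  have zp : z (k + m l) < p (k + m l) by have [] := oz (k + m l).
  have := block_expand hq d u zp ip.
  rewrite zk modnMDl (modn_small (rp l)) divnMDl //.
  by rewrite (divn_small (rp l)) addn0.
have [f Hf] := choice block.
(* Equal classes give equal blocks, hence agreement on the window, hence equal points; so [s] is no
   longer than the column has classes. *)
have inj : {in s &, injective (fun x => rho (column j (f x)))}.
  move=> x y xs ys /rhoP e; apply: sep => // i il.
  have -> : i = (`|(i + (r l)%:Z)%R|%N%:Z - (r l)%:Z)%R by lia.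
  by rewrite (Hf x) ?(Hf y) ?e //; lia.
apply: leq_trans sc; rewrite -(size_map (fun x => rho (column j (f x)))).
rewrite -(card_uniqP _); last by rewrite map_inj_in_uniq.
apply: subset_leq_card; apply/fintype.subsetP => _ /mapP[x _ ->].
exact: (codom_f (fun a : A (k + m l) => rho (column j a))).
Qed.

Lemma some_fibre c M :
  (forall k j, j < len q M k.+1 -> c <= spread M k.+1 j) ->
  (forall m, M <= m -> exists k j, j < len q m k.+1 /\ spread m k.+1 j <= c) ->
  exists2 z, odometer q z & fibre z #= `I_c.
Proof.
move=> hge /small_fibre[z oz hz]; exists z => //.
have fF : finite_set (fibre z).
  apply: contrapT => /(@infinite_set_fset _ _ c.+1)[s sF cs].
  have := hz (finmap.enum_fset s) (finmap.fset_uniq s).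
  by rewrite leqNgt cs => /(_ _)/wrap[] // x xs; exact: sF.
have [n Fn] := (finite_setP _).1 fF.
have nc : n <= c.
  rewrite -(card_fset_set Fn); apply: hz => [|x]; first exact: finmap.fset_uniq.
  by rewrite in_fset_set // inE.
move: nc; rewrite leq_eqVlt => /orP[/eqP <- //|/(no_small_fibre hge oz)].
by [].
Qed.

End Counting.

(** * The naive column number *)

(** [g] factors through [f]. The factor needs a default index, so an empty [I] is treated apart. *)
Lemma card_codom_le (I : finType) (S T : finType) (f : I -> S) (g : I -> T) :
  (forall a b, f a = f b -> g a = g b) -> #|codom g| <= #|codom f|.
Proof.
move=> fg; have [a0 _|I0] := pickP (@predT I); last first.
  have -> // : #|codom g| = 0.
  by apply: eq_card0 => r; apply/negP => /codomP[a]; have := I0 a.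
pose h r := g (odflt a0 [pick a | f a == r]).
apply: leq_trans (leq_image_card h (mem (codom f))).
apply: subset_leq_card; apply/fintype.subsetP => _ /codomP[a ->].
apply/fintype.imageP; exists (f a); first exact: codom_f.
rewrite /h; case: pickP => [b /eqP fb|/(_ a)]; last by rewrite eqxx.
by apply: fg; rewrite fb.
Qed.

Lemma card_codom_eq (I : finType) (S T : finType) (f : I -> S) (g : I -> T) :
  (forall a b, f a = f b <-> g a = g b) -> #|codom g| = #|codom f|.
Proof.
by move=> fg; apply/eqP; rewrite eqn_leq !card_codom_le // => a b /fg.
Qed.

(** [infimum] is a choice with default 0; the minimum of a nonempty set of naturals is an infimum,
    and infima are unique. *)
Lemma nat_infimumP (S : set nat) : S !=set0 ->
  S (infimum 0 S) /\ forall x, S x -> infimum 0 S <= x.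
Proof.
move=> [x Sx].
have ex : exists n, `[< S n >] by exists x; apply/asboolP.
case: (ex_minnP ex) => v /asboolP Sv vmin.
have le y : S y -> v <= y by move=> Sy; apply: vmin; apply/asboolP.
suff -> : infimum 0 S = v by [].
have iv : infimums S v.
  by split=> [y Sy|y Hy]; [rewrite leEnat; exact: le | exact: Hy].
rewrite /infimum; case: eqP => [S0|_]; first by rewrite S0 in Sx.
exact: (@is_subset1_infimums _ _ S _ _ (@xgetI _ 0 _ _ iv) iv).
Qed.

Lemma nondecreasing_bounded_stationary (f : nat -> nat) K :
  (forall m, f m <= f m.+1) -> (forall m, f m <= K) ->
  exists M, forall m, M <= m -> f m = f M.
Proof.
move=> fS fK.
have ex : exists v, `[< exists m, f m = v >].
  by exists (f 0); apply/asboolP; exists 0.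
have ub v : `[< exists m, f m = v >] -> v <= K by move=> /asboolP[m <-].
case: (ex_maxnP ex ub) => v /asboolP[M <-] vmax; exists M => m Mm.
apply/eqP; rewrite eqn_leq; apply/andP; split.
  by apply: vmax; apply/asboolP; exists m.
by rewrite -(subnK Mm); elim: (m - M) => // k IH; exact: leq_trans IH (fS _).
Qed.

Section ColumnNumber.
Variables (A : nat -> finType) (q : nat -> nat) (theta : directive A).
Hypothesis hq : constant_length theta q.
Variable d : forall n, A n.

Lemma onth_column m k j (a : A (k + m)) : j < len q m k ->
  onth (@compose A theta m k a) j = Some (@column A theta d m k j a).
Proof.
by move=> jl; rewrite onthE (nth_map (d m)) ?(size_compose hq).
Qed.

Lemma column_cardE m k j : j < len q m k ->
  column_card theta m k j = spread theta d (fun _ => id) m k j.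
Proof.
move=> jl; apply: card_codom_eq => a b; rewrite !onth_column //.
by split=> [->|[->]].
Qed.

Lemma quotient_period m k : period q (k + m) %/ period q m = len q m k.
Proof. by rewrite period_len mulKn // (period_gt0 hq d). Qed.

Lemma column_inf_ge m k j :
  j < len q m k.+1 -> column_inf q theta m <= column_card theta m k.+1 j.
Proof.
move=> jl; have [|_] := @nat_infimumP [set c | exists k j,
    j < period q (k.+1 + m) %/ period q m /\ c = column_card theta m k.+1 j].
  by eexists; exists k, j; rewrite quotient_period.
by apply; exists k, j; rewrite quotient_period.
Qed.

Lemma column_inf_attained m : exists k j,
  j < len q m k.+1 /\ column_inf q theta m = column_card theta m k.+1 j.
Proof.
have [|[k [j]]] := @nat_infimumP [set c | exists k j,
    j < period q (k.+1 + m) %/ period q m /\ c = column_card theta m k.+1 j].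
  by eexists; exists 0, 0; rewrite quotient_period (len_gt0 hq d).
by rewrite quotient_period => -[jl e] _; exists k, j.
Qed.

(** Take an optimal column at level m+1 and keep the first letter of each theta^(m)-image: this is a
    column at level [m], and no larger. *)
Lemma column_inf_nondecreasing m :
  column_inf q theta m <= column_inf q theta m.+1.
Proof.
have [k [j [jk ->]]] := column_inf_attained m.+1.
have l1 := len_gt0 hq d m 1.
have jk' : j * len q m 1 + 0 < len q m (k.+1 + 1).
  by rewrite (len_add q) -[1 + m]/m.+1; nia.
rewrite (column_cardE jk).
apply: leq_trans (@column_inf_ge m (k + 1) _ jk') _; rewrite column_cardE //.
have H := @spread_add A q theta hq d A (fun _ => id) m 1 k.+1 0 j l1 jk.
apply: leq_trans (subset_leq_card (introT (fintype.subsetP) H)) _.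
by apply: card_codom_le => a b ->.
Qed.

(** The infima are nondecreasing and bounded by the alphabet size, so they are constant from some
    [M] on, and the limit is that constant. *)
Lemma injective_column_numberP : bounded_size A ->
  exists M, (forall k j, j < len q M k.+1 ->
      injective_column_number q theta <= column_card theta M k.+1 j) /\
    (forall m, M <= m -> exists k j, j < len q m k.+1 /\
      column_card theta m k.+1 j <= injective_column_number q theta).
Proof.
move=> [K hK].
have [m|M HM] :=
  nondecreasing_bounded_stationary column_inf_nondecreasing (K := K).
  have [k [j [_ ->]]] := column_inf_attained m.
  exact: leq_trans (leq_image_card _ _) (hK _).
have -> : injective_column_number q theta = column_inf q theta M.
  apply: lim_near_cst; first exact: discrete_hausdorff.
  by exists M => // m /= Mm; exact: HM.
exists M; split=> [k j|m Mm]; first exact: column_inf_ge.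
have [k [j [jk e]]] := column_inf_attained m.
by exists k, j; rewrite -e HM.
Qed.

(** Induction on [n]: theta^[0,n+1)(a) concatenates the theta^[0,n)-words of the letters of
    theta^(n)(a), all of length p_n, so it can be compared letter by letter. *)
Lemma base_classes (B : nat -> finType) (rho : forall n, A n -> B n) :
  injective (rho 0) ->
  (forall n (a b : A n.+1),
     rho _ a = rho _ b <-> map (rho n) (theta n a) = map (rho n) (theta n b)) ->
  forall n (a b : A n), rho n a = rho n b <->
    forall j, j < period q n ->
      @base A q theta d n j a = @base A q theta d n j b.
Proof.
move=> inj0 injS; elim=> [|n IH] a b.
  split=> [/inj0 -> //|/(_ 0)]; rewrite /= /period big_ord0 => -> //.
have p0 := period_gt0 hq d n.
rewrite injS; split=> [e j|H].
  rewrite periodS mulnC -ltn_divLR // => jq /=.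
  apply: (IH _ _).1; last by rewrite ltn_pmod.
  have := congr1 (fun s => nth (rho n (d n)) s (j %/ period q n)) e.
  by rewrite !(nth_map (d n)) ?hq.
apply: (@eq_from_nth _ (rho n (d n))); first by rewrite !size_map !hq.
move=> i; rewrite size_map hq => iq; rewrite !(nth_map (d n)) ?hq //.
apply/IH => j jp; have := H (i * period q n + j); rewrite periodS /=.
rewrite modnMDl divnMDl // (modn_small jp) (divn_small jp) addn0; apply.
by nia.
Qed.

End ColumnNumber.

(** * Columns of the injectivisation *)

Section HatColumns.
Variables (A : nat -> finType) (q : nat -> nat) (theta : directive A).
Hypothesis hq : constant_length theta q.
Variable d : forall n, A n.

Lemma hat_constant_length : constant_length (injectivisation theta) q.
Proof.
move=> n b; have [a <-] := hat_tau_surj b.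
by rewrite -[LHS]/(size (hat_mor (hat_tau theta a))) hat_morE size_map hq.
Qed.

Lemma hat_bounded_size : bounded_size A -> bounded_size (hat_alphabet theta).
Proof.
move=> [K hK]; exists K => n; apply: leq_trans (hK n).
apply: leq_trans (leq_image_card (@hat_tau _ theta n) predT).
apply: subset_leq_card; apply/fintype.subsetP => b _.
by have [a <-] := hat_tau_surj b; exact: codom_f.
Qed.

Lemma compose_hat n k (a : A (k + n)) :
  @compose _ (injectivisation theta) n k (hat_tau theta a) =
  map (@hat_tau _ theta n) (@compose A theta n k a).
Proof.
elim: k a => [//|k IH] a /=.
rewrite /eta_of map_flatten -!map_comp.
by congr flatten; apply: eq_map => b; exact: IH.
Qed.

(** The quotient maps are onto and commute with the morphisms, so the columns can be counted within
    [theta] itself, where minimality and [pi] are available. *)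
Lemma hat_column_cardE m k j : j < len q m k ->
  column_card (injectivisation theta) m k j =
  spread theta d (@hat_tau _ theta) m k j.
Proof.
move=> jl; rewrite /column_card.
have -> :
    #|codom (fun b => onth (@compose _ (injectivisation theta) m k b) j)| =
    #|codom (fun a : A (k + m) =>
       onth (@compose _ (injectivisation theta) m k (hat_tau theta a)) j)|.
  apply: eq_card => r; apply/codomP/codomP => -[b ->]; last by eexists.
  by have [a <-] := hat_tau_surj b; exists a.
apply: card_codom_eq => a b.
rewrite !compose_hat !onthE -!map_comp !(nth_map (d m)) ?(size_compose hq) //=.
by split=> [->|[->]].
Qed.

End HatColumns.

Theorem corollary45 (A : nat -> finType) (q : nat -> nat)
    (theta : directive A) (pi : fullshift (A 0) -> odometer_space)
    (hbounded : bounded_size A) (htf : torsion_free q theta)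
    (hpi : tiling_factor_map q theta pi) :
  (exists2 z, odometer q z &
     (@subshift A theta 0 `&` pi @^-1` [set z])
       #= `I_(naive_column_number q theta)) /\
  (forall k, k < naive_column_number q theta ->
     forall z, odometer q z ->
       ~ ((@subshift A theta 0 `&` pi @^-1` [set z]) #= `I_k)).
Proof.
have [hq hgt1 hmin _ _] := htf.
pose d n : A n := projT1 (cid (hmin n).1) 0%R.
(* Both cases of the column number are brought to one form: [rho] is the identity if [theta] is
   injective, and [hat_tau] otherwise. *)
have [B [rho [rhoP [M [hge hle]]]]] : exists (B : nat -> finType)
    (rho : forall n, A n -> B n),
    (forall n (a b : A n), rho n a = rho n b <-> forall j, j < period q n ->
       @base A q theta d n j a = @base A q theta d n j b) /\
    exists M, (forall k j, j < len q M k.+1 ->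
        naive_column_number q theta <= spread theta d rho M k.+1 j) /\
      (forall m, M <= m -> exists k j, j < len q m k.+1 /\
        spread theta d rho m k.+1 j <= naive_column_number q theta).
  rewrite /naive_column_number; case: asboolP => [inj|_].
    exists A, (fun _ => id); split.
      apply: (base_classes hq) => // n a b.
      by rewrite !map_id; split=> [->|/inj].
    have [M [hge hle]] := injective_column_numberP hq d hbounded.
    exists M; split=> [k j jk|m /hle[k [j [jk]]]].
      by rewrite -(column_cardE hq) //; exact: hge.
    by rewrite (column_cardE hq d jk); exists k, j.
  exists (hat_alphabet theta), (@hat_tau _ theta); split.
    by apply: (base_classes hq) => // n a b; exact: hat_tau_eq.
  have [M [hge hle]] := injective_column_numberP
    (hat_constant_length hq) (fun n => hat_tau theta (d n))
    (hat_bounded_size theta hbounded).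
  exists M; split=> [k j jk|m /hle[k [j [jk]]]].
    by rewrite -(hat_column_cardE hq) //; exact: hge.
  by rewrite (hat_column_cardE hq d jk); exists k, j.
split; first exact: (some_fibre hq hgt1 hmin hpi rhoP hge hle).
move=> k kc z oz; exact: (no_small_fibre hq hgt1 hmin hpi rhoP hge oz kc).
Qed.
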